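(* Let $d \geq 3$ be an odd integer and let $k \geq 1$ be an integer. Then the polynomials $\phi_{2^k+1}(x,y,z)$ and $\phi_d(x,y,z)$ are relatively prime, except when $d = 2^l+1$ for some positive integer $l$ with $\gcd(l,k) > 1$. That is, if $d$ is not of the form $2^l+1$ with $\gcd(l,k)>1$, then $\phi_{2^k+1}$ and $\phi_d$ are relatively prime.
   Context: For an integer $j \geq 3$, $\phi_j(x,y,z)$ denotes the polynomial over $\mathbb{F}_2$ (homogeneous of degree $j-3$ when nonzero) given by $$\phi_j(x,y,z)=\frac{x^j+y^j+z^j+(x+y+z)^j}{(x+y)(x+z)(y+z)};$$ in characteristic 2 the denominator divides the numerator, so this is indeed a polynomial in $\mathbb{F}_2[x,y,z]$. Two polynomials are relatively prime if they have no nonconstant common factor; for polynomials over $\mathbb{F}_2$ this condition is the same whether considered over $\mathbb{F}_2$ or over any extension field, such as $\overline{\mathbb{F}}_2$. *)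

(* Defs.v *)
From mathcomp Require Import all_boot all_order all_algebra.
From mathcomp Require Import mpoly ring.

Set Implicit Arguments.
Unset Strict Implicit.
Unset Printing Implicit Defensive.

Import GRing.Theory.
Local Open Scope ring_scope.

Local Notation x := ('X_(inord 0) : {mpoly 'F_2[3]}).
Local Notation y := ('X_(inord 1) : {mpoly 'F_2[3]}).
Local Notation z := ('X_(inord 2) : {mpoly 'F_2[3]}).

Definition phi_num (j : nat) : {mpoly 'F_2[3]} :=
  x ^+ j + y ^+ j + z ^+ j + (x + y + z) ^+ j.

Definition phi_den : {mpoly 'F_2[3]} := (x + y) * (x + z) * (y + z).

Lemma phi_num_rec (R : comNzRingType) (a b c w : R) (j : nat) :
  let S i := a ^+ i + b ^+ i + c ^+ i + w ^+ i in
  S j.+4 = (a + b + c + w) * S j.+3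
         - (a * b + a * c + a * w + b * c + b * w + c * w) * S j.+2
         + (a * b * c + a * b * w + a * c * w + b * c * w) * S j.+1
         - a * b * c * w * S j.
Proof. by rewrite /= !exprS; ring. Qed.

Lemma mpoly2_char (p : {mpoly 'F_2[3]}) : p *+ 2 = 0.
Proof.
apply/mpolyP=> m; rewrite mcoeffMn mcoeff0 -mulr_natr.
have -> : 2%:R = 0 :> 'F_2 by apply/eqP.
by rewrite mulr0.
Qed.

Lemma phi_exists (j : nat) : exists q, q * phi_den == phi_num j.
Proof.
suff: [/\ exists q, q * phi_den = phi_num j,
          exists q, q * phi_den = phi_num j.+1,
          exists q, q * phi_den = phi_num j.+2 &
          exists q, q * phi_den = phi_num j.+3].
  by case=> -[q <-] _ _ _; exists q.
elim: j => [|j [[q0 e0] [q1 e1] [q2 e2] [q3 e3]]].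
  split; [exists 0|exists 0|exists 0|exists 1];
    rewrite ?mul0r ?mul1r /phi_num /phi_den; apply/esym.
  - transitivity ((1 + 1 : {mpoly 'F_2[3]}) *+ 2); first by ring.
    exact: mpoly2_char.
  - transitivity ((x + y + z) *+ 2); first by ring.
    exact: mpoly2_char.
  - transitivity ((x ^+ 2 + y ^+ 2 + z ^+ 2 + x * y + x * z + y * z) *+ 2).
      by ring.
    exact: mpoly2_char.
  - transitivity (phi_den
      + (x ^+ 3 + y ^+ 3 + z ^+ 3 + phi_den) *+ 2).
      by rewrite /phi_den; ring.
    by rewrite mpoly2_char addr0.
split; [by exists q1|by exists q2|by exists q3|].
rewrite {1}/phi_num phi_num_rec -!/(phi_num _) -e0 -e1 -e2 -e3.
move: phi_den {e0 e1 e2 e3} => D.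
rewrite !mulrA -!mulrBl -mulrDl -mulrBl; eexists; reflexivity.
Qed.

(* No division is available in [{mpoly 'F_2[3]}]: [phi j] is the quotient
   [phi_num j / phi_den], characterized by [phiP] and [phi_unique] (for j < 3
   it is the corresponding quotient, namely 0). *)
Definition phi (j : nat) : {mpoly 'F_2[3]} := xchoose (phi_exists j).

Lemma phiP (j : nat) : phi j * phi_den = phi_num j.
Proof. exact/eqP/(xchooseP (phi_exists j)). Qed.

Lemma phi_den_neq0 : phi_den != 0.
Proof.
have H (i j : 'I_3) : i != j -> 'X_i + 'X_j != 0 :> {mpoly 'F_2[3]}.
  move=> ij; apply/eqP=> /(congr1 (mcoeff U_(i))).
  rewrite mcoeffD mcoeff0 !mcoeffXU eqxx eq_sym (negbTE ij) addr0.
  by move/eqP; rewrite oner_eq0.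
by rewrite /phi_den !mulf_neq0 // H // -val_eqE /= !inordK.
Qed.

Lemma phi_unique (j : nat) (q : {mpoly 'F_2[3]}) :
  q * phi_den = phi_num j -> q = phi j.
Proof. by rewrite -phiP; apply/mulIf/phi_den_neq0. Qed.

Definition mdvd (n : nat) (F : fieldType) (p q : {mpoly F[n]}) : Prop :=
  exists r : {mpoly F[n]}, q = r * p.

Definition mconstant (n : nat) (F : fieldType) (p : {mpoly F[n]}) : Prop :=
  exists c : F, p = c%:MP.

Definition relatively_prime (n : nat) (F : fieldType) (p q : {mpoly F[n]}) :
    Prop :=
  forall h : {mpoly F[n]}, mdvd h p -> mdvd h q -> mconstant h.

(* Main.v *)
(** Over K = F_(2^k), phi_(2^k+1) is the product of the linear forms
    l_e = (x + z) - e (y + z) for e in K distinct from 0 and 1.  A nonconstant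
    common factor is thus divisible by some l_e, so phi_d vanishes on the plane
    l_e = 0; along the line (1 + e u, 1 + u, 1) of that plane this says
      (1 + e u)^d + (1 + u)^d + 1 + (1 + (e + 1) u)^d = 0.
    Write d = 1 + q m with q = 2^a and m odd.  If 'C(m, j) is odd and j > 0, the
    coefficients of u^(q j) and u^(q j + 1) give e^(q j) = e.  If m > 1, then
    j = m and j = m - 1 force e^q = 1, hence e = 1.  So m = 1, d = 2^a + 1 and
    e^(2^a) = e; as also e^(2^k) = e, gcd(a, k) = 1 would give e^2 = e. *)

Require Import Defs.
From mathcomp Require Import all_boot all_order all_algebra.
From mathcomp Require Import finfield.
From mathcomp Require Import mpoly ring.

Set Implicit Arguments.
Unset Strict Implicit.
Unset Printing Implicit Defensive.

Import GRing.Theory.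
Local Open Scope ring_scope.

(** * Characteristic 2 and the factorization of the numerator at 2^k + 1 *)

Lemma pchar2_mulr2n (R : nzRingType) (char2 : 2 \in [pchar R]) (a : R) :
  a *+ 2 = 0.
Proof. by rewrite -mulr_natr pcharf0 ?mulr0. Qed.

Lemma pchar2_exprD (R : comNzRingType) (char2 : 2 \in [pchar R]) (k : nat)
    (a b : R) :
  (a + b) ^+ (2 ^ k) = a ^+ (2 ^ k) + b ^+ (2 ^ k).
Proof.
by apply: exprDn_pchar; rewrite (eq_pnat _ (pcharf_eq char2)) pnatX orTb.
Qed.

(** Homogeneous form of the identity T^q - T = prod (T - c) over the field of q elements. The case b
    = 0 is apart, since the roots [f c * b] then coincide. *)
Lemma prod_sub_scaled (K : finFieldType) (R : idomainType)
    (f : {rmorphism K -> R}) (a b : R) :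
  \prod_(c : K) (a - f c * b) = a ^+ #|K| - a * b ^+ #|K|.-1.
Proof.
have q_gt1 := finNzRing_gt1 K; have q_gt0 := ltnW q_gt1.
have [->|b_neq0] := eqVneq b 0.
  under eq_bigr do rewrite mulr0 subr0.
  rewrite prodr_const expr0n; case: #|K| q_gt1 => [|[]] // q _.
  by rewrite mulr0 subr0.
pose rs := [seq f c * b | c <- enum K].
have size_rs : size rs = #|K| by rewrite size_map cardE.
pose t : {poly R} := - (b ^+ #|K|.-1 *: 'X).
have size_t : (size t <= #|K|)%N.
  by rewrite size_polyN (leq_trans (size_scale_leq _ _)) // size_polyX.
pose p := \prod_(z <- rs) ('X - z%:P) - ('X^#|K| + t).
suff p0 : p = 0.
  move/(congr1 (horner^~ a)): p0.
  rewrite /p /t !hornerE horner_prod big_map big_enum /= => /eqP.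
  rewrite subr_eq0 [a * _]mulrC => /eqP <-.
  by apply: eq_bigr => c _; rewrite !hornerE.
(* [p] has the #|K| roots [f c * b], and its degree is less than #|K|. *)
apply: (@roots_geq_poly_eq0 _ _ rs).
- apply/allP=> r rs_r; rewrite /root /p /t !hornerE.
  have /eqP-> : (\prod_(z <- rs) ('X - z%:P)).[r] == 0.
    by rewrite -/(root _ _) root_prod_XsubC.
  case/mapP: rs_r => c _ ->.
  rewrite exprMn -rmorphXn expf_card mulrCA -exprSr prednK //.
  by rewrite subrr subr0.
- rewrite map_inj_uniq ?enum_uniq // => c c' /(mulIf b_neq0).
  exact: fmorph_inj.
- rewrite size_rs; apply/leq_sizeP => j; rewrite leq_eqVlt => /orP[/eqP <-|lt_j].
    rewrite coefB; have := monic_prod_XsubC rs xpredT id.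
    rewrite monicE /lead_coef size_prod_XsubC size_rs /= => /eqP->.
    by rewrite coefD coefXn eqxx (nth_default _ size_t) addr0 subrr.
  rewrite nth_default // (leq_trans _ lt_j) //.
  rewrite (leq_trans (size_polyD _ _)) // geq_max size_prod_XsubC size_rs leqnn.
  rewrite size_polyN (leq_trans (size_polyD _ _)) // geq_max size_polyXn leqnn.
  exact: leqW.
Qed.

Lemma phi_num_factor (K : finFieldType) (R : idomainType) (k : nat)
    (f : {rmorphism K -> R}) (a b c : R) :
  2 \in [pchar R] -> #|K| = (2 ^ k)%N ->
  let d := (2 ^ k + 1)%N in
  a ^+ d + b ^+ d + c ^+ d + (a + b + c) ^+ d =
  (\prod_(e | (e != 0) && (e != 1)) (a + c - f e * (b + c)))
    * ((a + b) * (a + c) * (b + c)).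
Proof.
move=> char2 cardK d.
have := prod_sub_scaled f (a + c) (b + c).
(* The factors at 0 and 1 are a + c and a - b = a + b: with b + c, they form the denominator. *)
rewrite (bigD1 0) //= (bigD1 1) /=; last by rewrite oner_neq0.
rewrite rmorph0 rmorph1 mul0r mul1r subr0.
move: (\prod_(e | _) _) => P eP.
have {}eP : P * ((a + b) * (a + c) * (b + c)) =
    (a + c) ^+ #|K| * (b + c) - (a + c) * (b + c) ^+ #|K|.
  rewrite -[X in (b + c) ^+ X](prednK (ltnW (finNzRing_gt1 K))) exprSr.
  rewrite [in RHS]mulrA -mulrBl -eP.
  rewrite -[b in a + b](oppr_pchar2 char2); ring.
rewrite eP cardK /d !addn1 !exprSr !(pchar2_exprD char2) (oppr_pchar2 char2).
set A := a ^+ _; set B := b ^+ _; set C := c ^+ _.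
transitivity ((A + C) * (b + c) + (a + c) * (B + C) + (A * a + B * b) *+ 2).
  ring.
by rewrite (pchar2_mulr2n char2) addr0.
Qed.

(** * Divisibility by linear forms *)

(* For h a substitution that solves the linear equation l = 0 for one variable,
   this is division by l: the remainder is the value of p under h. *)
Lemma mmap_sub_dvd (n : nat) (F : fieldType) (l : {mpoly F[n]})
    (h : 'I_n -> {mpoly F[n]}) (p : {mpoly F[n]}) :
  (forall i, mdvd l ('X_i - h i)) -> mdvd l (p - mmap (@mpolyC n F) h p).
Proof.
move=> dvd_h; elim/mpolyind: p => [|c m p _ _ [r er]].
  by exists 0; rewrite rmorph0 subr0 mul0r.
suff [s es] : mdvd l ('X_[m] - mmap1 h m).
  exists (c *: s + r); rewrite mulrDl -er -scalerAl -es.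
  by rewrite rmorphD /= mmapZ mmapX /= mul_mpolyC scalerBr opprD addrACA.
(* Congruence modulo [l] respects products, so it passes from the variables to monomials. *)
pose Q (u v : {mpoly F[n]}) := mdvd l (u - v).
have QM u v u' v' : Q u v -> Q u' v' -> Q (u * u') (v * v').
  move=> [s es] [t et]; exists (u * t + v' * s).
  by rewrite mulrDl -!mulrA -es -et; ring.
have Q1 : Q 1 1 by exists 0; rewrite subrr mul0r.
rewrite mpolyXE_id /mmap1.
elim/big_ind2: _ => [|u v u' v'|i _]; [exact: Q1|exact: QM|].
by elim: (m i) => [|j IHj]; rewrite ?expr0 // !exprS; apply: QM (dvd_h i) IHj.
Qed.

Lemma mconstant_dvdC (n : nat) (F : fieldType) (p : {mpoly F[n]}) (c : F) :
  c != 0 -> mdvd p c%:MP -> mconstant p.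
Proof.
move=> c0 [r er]; have : r * p != 0 by rewrite -er mpolyC_eq0.
rewrite mulf_eq0 negb_or => /andP[r0 p0].
have := msizeM r0 p0; rewrite -er msizeC c0 => e.
exists (p@_0); apply: msize1_polyC.
(* For a nonzero polynomial [msize] is the degree plus one, hence the predecessor in the size of a
   product. *)
have aux (u v : nat) : u != 0%N -> v != 0%N -> 1%N = (u + v).-1 -> (v <= 1)%N.
  by case: u v => [|u] [|[|v]] //= _ _; rewrite !addnS.
by apply: aux e; rewrite msize_poly_eq0.
Qed.

(** Each [l i] acts as a prime: it divides whatever vanishes under [h i], and substitution lands in
    a domain. So either it divides p, or it divides the cofactor of p and cancels, leaving a shorter
    product. *)
Lemma constant_or_root (n : nat) (F : fieldType) (I : eqType)
    (l : I -> {mpoly F[n]}) (h : I -> 'I_n -> {mpoly F[n]}) (s : seq I)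
    (p : {mpoly F[n]}) :
  (forall i, l i != 0) ->
  (forall i, mmap (@mpolyC n F) (h i) (l i) = 0) ->
  (forall i j, mdvd (l i) ('X_j - h i j)) ->
  mdvd p (\prod_(i <- s) l i) ->
  mconstant p \/ exists2 i, i \in s & mdvd (l i) p.
Proof.
move=> l_neq0 l_root dvd_l; elim: s => [|i s IHs] dvd_p.
  left; move: dvd_p; rewrite big_nil -mpolyC1; apply: mconstant_dvdC.
  exact: oner_neq0.
have dvd_root q : mmap (@mpolyC n F) (h i) q = 0 -> mdvd (l i) q.
  by move=> q0; have := mmap_sub_dvd q (dvd_l i); rewrite q0 subr0.
case: dvd_p => r; rewrite big_cons => e.
have /eqP := congr1 (mmap (@mpolyC n F) (h i)) e.
rewrite !rmorphM /= l_root mul0r eq_sym mulf_eq0 => /orP[]/eqP/dvd_root.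
  case=> t et; case: IHs => [||[j s_j dvd_j]]; [|by left|].
    exists t; apply: (mulfI (l_neq0 i)).
    by rewrite e et; ring.
  by right; exists j; rewrite // inE s_j orbT.
by move=> dvd_i; right; exists i; rewrite // mem_head.
Qed.

(** * Sums of powers of binomials in one variable *)

(** By Frobenius the power is (1 + cX)(1 + c^q X^q)^m. As q > 1, the terms 1 and cX contribute to
    exponents 0 and 1 modulo q, which never overlap. *)
Lemma coef_binomial_pow2 (K : fieldType) (a m j : nat) (c : K) :
  2 \in [pchar K] -> (0 < a)%N -> let q := (2 ^ a)%N in
  let p := (1 + c *: 'X) ^+ (1 + q * m) in
  p`_(q * j) = c ^+ (q * j) *+ 'C(m, j) /\
  p`_(q * j + 1) = c ^+ (q * j + 1) *+ 'C(m, j).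
Proof.
move=> char2 a_gt0 q /=.
have q_gt1 : (1 < q)%N by rewrite -{1}[1%N](expn0 2) ltn_exp2l.
rewrite exprD expr1.
have -> : (1 + c *: 'X) ^+ (q * m) = ((1 + (c ^+ q) *: 'X) ^+ m) \Po 'X^q.
  rewrite exprM pchar2_exprD ?pchar_lalg // expr1n exprZn rmorphXn /=.
  by rewrite comp_polyD comp_polyZ comp_polyX comp_polyC.
set P := _ ^+ m.
have coefP i : P`_i = c ^+ (q * i) *+ 'C(m, i).
  rewrite /P exprDn coef_sum.
  under eq_bigr do rewrite expr1n mul1r exprZn coefMn coefZ coefXn -exprM.
  have [le_im|lt_mi] := leqP i m.
    rewrite (bigD1 (Ordinal (le_im : (i < m.+1)%N))) //= eqxx mulr1 big1 ?addr0 //.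
    move=> k; rewrite -val_eqE /= eq_sym => /negbTE->.
    by rewrite mulr0 mul0rn.
  rewrite bin_small // mulr0n big1 // => k _.
  by rewrite gtn_eqF ?mulr0 ?mul0rn // (leq_trans (ltn_ord k)).
have q_gt0 := ltnW q_gt1.
have ndvdS i : (q %| i -> q %| i.+1 = false)%N.
  by move=> dvd_i; rewrite -addn1 dvdn_addr // dvdn1 gtn_eqF.
rewrite addn1 !mulrDl !mul1r !coefD -!scalerAl !coefZ !coefXM /=.
rewrite !coef_comp_poly_Xn // ndvdS ?dvdn_mulr // mulKn // add0r coefP.
split; last by rewrite mulrnAr exprS.
case: (q * j)%N (dvdn_mulr j (dvdnn q)) => [|i] dvd_i /=.
  by rewrite mulr0 addr0.
by case: ifP => [/ndvdS|_]; rewrite ?dvd_i // mulr0 addr0.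
Qed.

Lemma sum_powers_eq0 (K : fieldType) (d : nat) (e : K) :
  2 \in [pchar K] -> odd d -> (2 < d)%N -> e != 0 -> e != 1 ->
  (1 + e *: 'X) ^+ d + (1 + 'X) ^+ d + 1 + (1 + (e + 1) *: 'X) ^+ d = 0
    :> {poly K} ->
  exists l, [/\ (0 < l)%N, d = (2 ^ l + 1)%N & e ^+ (2 ^ l) = e].
Proof.
move=> char2 odd_d d_gt2 e_neq0 e_neq1 sum0.
have d1_gt0 : (0 < d.-1)%N by case: d d_gt2 {odd_d sum0} => [|[]].
have d1_even : ~~ odd d.-1 by case: d odd_d d_gt2 {sum0 d1_gt0}.
have [m] := pfactor_coprime (isT : prime 2) d1_gt0.
rewrite coprime2n; set a := logn 2 d.-1 => odd_m d1E.
have a_gt0 : (0 < a)%N.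
  by case: a d1E d1_even => // ->; rewrite expn0 muln1 odd_m.
have dE : d = (1 + 2 ^ a * m)%N by rewrite mulnC -d1E add1n prednK // ltnW // ltnW.
have key j : (0 < j)%N -> odd 'C(m, j) -> e ^+ (2 ^ a * j) = e.
  move=> j_gt0 odd_C.
  have coefE c := coef_binomial_pow2 m j c char2 a_gt0.
  have muln_C (c : K) : c *+ 'C(m, j) = c.
    rewrite -[in LHS](odd_double_half 'C(m, j)) odd_C -mul2n mulrnDr mulrnA.
    by rewrite (pchar2_mulr2n char2) mul0rn addr0.
  have coef_sum0 i : (0 < i)%N ->
      (forall c : K, ((1 + c *: 'X) ^+ d)`_i = c ^+ i) ->
      e ^+ i + 1 + (e + 1) ^+ i = 0.
    move=> i_gt0 coef_i; have := congr1 (coefp i) sum0.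
    rewrite /coefp /= !coefD coef0 coef1 gtn_eqF // addr0 !coef_i.
    by rewrite -['X]scale1r coef_i expr1n.
  have e0 : e ^+ (2 ^ a * j) + 1 + (e + 1) ^+ (2 ^ a * j) = 0.
    apply: coef_sum0 => [|c]; first by rewrite muln_gt0 expn_gt0.
    by rewrite dE (coefE c).1 muln_C.
  have e1 : e ^+ (2 ^ a * j + 1) + 1 + (e + 1) ^+ (2 ^ a * j + 1) = 0.
    apply: coef_sum0 => [|c]; first by rewrite addn1.
    by rewrite dE (coefE c).2 muln_C.
  rewrite !addn1 !exprS in e1.
  apply/eqP; rewrite -[X in _ == X](oppr_pchar2 char2) -addr_eq0; apply/eqP.
  set s := e ^+ _ in e0 e1 *; set t := (e + 1) ^+ _ in e0 e1.
  (* This combination eliminates t and leaves s + e. *)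
  transitivity ((e + 1) * (s + 1 + t) - (e * s + 1 + (e + 1) * t)).
    by ring.
  by rewrite e0 e1 mulr0 subr0.
have m_gt0 : (0 < m)%N by case: m odd_m {d1E dE key}.
have [m1|m_neq1] := eqVneq m 1%N.
  exists a; split=> //; first by rewrite dE m1 muln1 addnC.
  by rewrite -[RHS](key 1%N) ?m1 ?muln1.
(* Both 'C(m, m) = 1 and 'C(m, m - 1) = m are odd; the quotient of the two resulting equalities is
   e^(2^a) = 1. *)
have eX_m : e ^+ (2 ^ a * m) = e by apply: key; rewrite // binn.
have eX_m1 : e ^+ (2 ^ a * m.-1) = e.
  apply: key; first by case: m m_neq1 m_gt0 {odd_m d1E dE eX_m} => [|[]].
  by rewrite -subn1 bin_sub // bin1.
suff /eqP : (e + 1) ^+ (2 ^ a) = 0.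
  rewrite expf_eq0 => /andP[_ /eqP e1]; case/eqP: e_neq1.
  by rewrite -[RHS](oppr_pchar2 char2); apply/eqP; rewrite -addr_eq0 e1.
rewrite (pchar2_exprD char2) expr1n; suff -> : e ^+ (2 ^ a) = 1.
  by rewrite -mulr2n (pchar2_mulr2n char2).
apply: (mulfI e_neq0); rewrite mulr1 -[RHS]eX_m -[m in RHS]prednK // mulnS.
by rewrite addnC exprD eX_m1.
Qed.

(** Bezout gives natural u, v with 1 + v k = u l. Raising e to the power p^(u l) yields e, while
    p^(1 + v k) yields e^p. *)
Lemma frobenius_fixed_coprime (R : nzSemiRingType) (p l k : nat) (e : R) :
  (0 < l)%N -> coprime l k ->
  e ^+ (p ^ l) = e -> e ^+ (p ^ k) = e -> e ^+ p = e.
Proof.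
move=> l_gt0 /eqP gcd1 el ek.
have iter_fix n u : e ^+ (p ^ n) = e -> e ^+ (p ^ (u * n)) = e.
  by move=> en; elim: u => [|u IHu]; rewrite ?expr1 // mulSn expnD exprM en.
have [v _] := Bezoutl k l_gt0; rewrite gcd1 => /dvdnP[u uE].
have := iter_fix _ u el; rewrite -uE expnD expn1 mulnC exprM.
by rewrite iter_fix.
Qed.

Lemma pow2_field_extension (k : nat) : (0 < k)%N ->
  exists (K : finFieldType) (f : {rmorphism 'F_2 -> K}), #|K| = (2 ^ k)%N.
Proof.
move=> k_gt0; have [K charK cardK] := pPrimePowerField (isT : prime 2) k_gt0.
by exists (pPrimeCharType charK), (in_alg (pPrimeCharType charK)).
Qed.

(** * Common factors over the field of 2^k elements *)

Theorem theorem10 (d k : nat) (d_ge3 : (3 <= d)%N) (d_odd : odd d)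
    (k_ge1 : (1 <= k)%N)
    (d_nonexc : ~ exists l : nat,
      [/\ (0 < l)%N, d = (2 ^ l + 1)%N & (1 < gcdn l k)%N]) :
  relatively_prime (phi (2 ^ k + 1)%N) (phi d).
Proof.
have [K [f cardK]] := pow2_field_extension k_ge1.
have charK : 2 \in [pchar K] by rewrite (rmorph_pchar f) // pchar_Fp.
move=> p [u up] [v vp].
pose X (i : nat) : {mpoly K[3]} := 'X_(inord i).
have F_num j : map_mpoly f (phi_num j) =
    X 0%N ^+ j + X 1%N ^+ j + X 2%N ^+ j + (X 0%N + X 1%N + X 2%N) ^+ j.
  by rewrite /phi_num !(rmorphD, rmorphXn) /= !map_mpolyX.
have F_den : map_mpoly f phi_den =
    (X 0%N + X 1%N) * (X 0%N + X 2%N) * (X 1%N + X 2%N).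
  by rewrite /phi_den !(rmorphM, rmorphD) /= !map_mpolyX.
have F_eq0 (a : {mpoly 'F_2[3]}) : map_mpoly f a = 0 -> a = 0.
  move=> a0; apply/mpolyP=> m; apply: (fmorph_inj f).
  by rewrite -mcoeff_map_mpoly a0 !mcoeff0 rmorph0.
have char_mp : 2 \in [pchar {mpoly K[3]}] by rewrite pchar_lalg.
pose l (e : K) := X 0%N + X 2%N - e%:MP * (X 1%N + X 2%N).
pose s := enum [pred e : K | (e != 0) && (e != 1)].
have F_phi : map_mpoly f (phi (2 ^ k + 1)) = \prod_(e <- s) l e.
  apply: (@mulIf _ (map_mpoly f phi_den)).
    by apply: contraNneq phi_den_neq0 => /F_eq0->.
  rewrite -rmorphM /= phiP F_num F_den.
  by rewrite (phi_num_factor (@mpolyC 3 K) _ _ _ char_mp cardK) big_enum.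
have neq01 : inord 1 != inord 0 :> 'I_3 by rewrite -val_eqE /= !inordK.
have neq02 : inord 2 != inord 0 :> 'I_3 by rewrite -val_eqE /= !inordK.
have neq12 : inord 2 != inord 1 :> 'I_3 by rewrite -val_eqE /= !inordK.
(* Solves [l e] = 0 for the first variable. *)
pose h (e : K) (j : 'I_3) : {mpoly K[3]} :=
  if j == inord 0 then e%:MP * (X 1%N + X 2%N) - X 2%N else 'X_j.
have l_neq0 e : l e != 0.
  apply/eqP=> /(congr1 (mcoeff U_(inord 0))).
  rewrite /l mul_mpolyC mcoeffB mcoeffZ !mcoeffD mcoeff0 !mcoeffXU eqxx.
  rewrite (negbTE neq01) (negbTE neq02) !addr0 mulr0 subr0.
  by move/eqP; rewrite oner_eq0.
have l_root e : mmap (@mpolyC 3 K) (h e) (l e) = 0.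
  rewrite /l !(rmorphM, rmorphB, rmorphD) /= mmapC !mmapX !mmap1U /h eqxx.
  rewrite (negbTE neq01) (negbTE neq02).
  by rewrite -!/(X _) subrK subrr.
have dvd_l e j : mdvd (l e) ('X_j - h e j).
  rewrite /h; case: eqP => [->|_]; last by exists 0; rewrite subrr mul0r.
  by exists 1; rewrite /l /X; ring.
have dvd_p : mdvd (map_mpoly f p) (\prod_(e <- s) l e).
  by exists (map_mpoly f u); rewrite -F_phi up rmorphM.
have [[c pE]|[e s_e [w wE]]] := constant_or_root l_neq0 l_root dvd_l dvd_p.
  (* Constancy descends to F_2 because [f] is injective on coefficients. *)
  exists p@_0; apply/mpolyP=> m; apply: (fmorph_inj f).
  rewrite mcoeffC; case: eqP => [->|/eqP m0]; rewrite ?mulr1 // mulr0 rmorph0.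
  by rewrite -mcoeff_map_mpoly pE mcoeffC (negbTE m0) mulr0.
have [e0 e1] : e != 0 /\ e != 1.
  by move: s_e; rewrite mem_enum => /andP.
(* Restriction to the line (1 + e u, 1 + u, 1) in the plane [l e] = 0. *)
pose t (j : 'I_3) : {poly K} :=
  if j == inord 0 then 1 + e *: 'X else if j == inord 1 then 1 + 'X else 1.
have char_p : 2 \in [pchar {poly K}] by rewrite pchar_lalg.
have t0 : mmap polyC t (X 0%N) = 1 + e *: 'X by rewrite mmapX mmap1U /t eqxx.
have t1 : mmap polyC t (X 1%N) = 1 + 'X.
  by rewrite mmapX mmap1U /t eqxx (negbTE neq01).
have t2 : mmap polyC t (X 2%N) = 1.
  by rewrite mmapX mmap1U /t (negbTE neq12) (negbTE neq02).
have tl : mmap polyC t (l e) = 0.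
  rewrite /l !(rmorphM, rmorphB, rmorphD) /= mmapC t0 t1 t2 -mul_polyC.
  transitivity (1 *+ 2 - e%:P *+ 2 : {poly K}); first by ring.
  by rewrite !(pchar2_mulr2n char_p) subr0.
have sum0 : (1 + e *: 'X) ^+ d + (1 + 'X) ^+ d + 1 + (1 + (e + 1) *: 'X) ^+ d
    = 0 :> {poly K}.
  have := congr1 (mmap polyC t) (F_num d).
  rewrite -phiP vp !rmorphM /= wE !rmorphM /= tl !(mulr0, mul0r).
  rewrite !(rmorphXn, rmorphD) /= t0 t1 t2 expr1n => /esym <-.
  congr (_ + _ ^+ d).
  transitivity (1 + (e + 1) *: 'X + 1 *+ 2 : {poly K}).
    by rewrite (pchar2_mulr2n char_p) addr0.
  by rewrite -!mul_polyC rmorphD /=; ring.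
have [n [n_gt0 dE en]] := sum_powers_eq0 charK d_odd d_ge3 e0 e1 sum0.
case: d_nonexc; exists n; split=> //.
(* If n and k were coprime, e^2 = e would follow, and e = 1 as e is nonzero. *)
rewrite ltn_neqAle gcdn_gt0 n_gt0 andbT eq_sym; apply: contra e1 => co.
have ek : e ^+ (2 ^ k) = e by rewrite -cardK expf_card.
have := frobenius_fixed_coprime n_gt0 co en ek.
by move/eqP; rewrite expr2 -[X in _ == X]mulr1 (inj_eq (mulfI e0)).
Qed.
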